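(* Let $G$ be a finite $d$-regular graph with girth $c$. Let $S\ge 0$ be an integer. If $d\ge 3$ and $2S+1<c$, then the minimal variation of probability measures for $G$ at scale $S$ is $$\varepsilon_{S,G}=\frac{2(d-1)^S(2-d)}{2-d(d-1)^S}.$$
   Context: Graphs have no self-loops and no multiple edges; each edge is given one orientation, but degree, girth and the path-length metric are those of the underlying undirected graph. The girth is the length of a shortest cycle. $B(i,S)$ is the closed ball of radius $S$ about $i$ in the path-length metric (number of edges of a shortest undirected path). For a graph $G=(V,E)$, the minimal variation of probability measures $\varepsilon_{S,G}$ at scale $S$ is the minimal $\varepsilon\ge0$ for which there is a family of functions $\{\xi_i\colon V\to\mathbb{R}\}_{i\in V}$ with $\xi_i\ge 0$, $\|\xi_i\|_1=1$ and $\{j\in V:\xi_i(j)>0\}\subset B(i,S)$ for each $i\in V$, and $\|\xi_i-\xi_j\|_1\le\varepsilon$ for each $ij\in E$. *)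

(* Defs.v *)
From mathcomp Require Import all_boot all_order all_algebra.
From mathcomp Require Import reals.

Set Implicit Arguments.
Unset Strict Implicit.
Unset Printing Implicit Defensive.

Import Order.TTheory GRing.Theory Num.Theory.
Local Open Scope ring_scope.

(* [E i j] means that the edge {i, j} is present and oriented from i to j.    *)
(* Taking i = j shows that loops are excluded as well.                        *)
Definition oriented_graph (V : finType) (E : rel V) : Prop :=
  forall i j : V, E i j -> ~~ E j i.

Definition adj (V : finType) (E : rel V) : rel V :=
  [rel i j | E i j || E j i].

Definition regular (V : finType) (E : rel V) (d : nat) : Prop :=
  forall i : V, #|[set j | adj E i j]| = d.

(* [ucycle] alone also accepts the empty sequence and a traversal of a single *)
(* edge back and forth, hence the bound on the size.                          *)
Definition graph_cycle (V : finType) (E : rel V) (s : seq V) : Prop :=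
  (2 < size s)%N /\ ucycle (adj E) s.

(* The girth is a natural number only when there is a cycle: an acyclic graph *)
(* satisfies [is_girth E c] for no c.                                         *)
Definition is_girth (V : finType) (E : rel V) (c : nat) : Prop :=
  (exists2 s : seq V, graph_cycle E s & size s = c) /\
  (forall s : seq V, graph_cycle E s -> (c <= size s)%N).

Definition joins (V : finType) (E : rel V) (i j : V) (p : seq V) : Prop :=
  path (adj E) i p /\ last i p = j.

(* Relational, since vertices in different components are at no finite        *)
(* distance; [size p] counts the edges of the path i :: p.                    *)
Definition is_dist (V : finType) (E : rel V) (i j : V) (n : nat) : Prop :=
  (exists2 p : seq V, joins E i j p & size p = n) /\
  (forall p : seq V, joins E i j p -> (n <= size p)%N).

Definition in_ball (V : finType) (E : rel V) (i : V) (S : nat) (j : V) : Prop :=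
  exists2 n : nat, is_dist E i j n & (n <= S)%N.

Definition l1norm (R : realType) (V : finType) (f : V -> R) : R :=
  \sum_(j : V) `|f j|.

Definition prob_family (R : realType) (V : finType) (E : rel V) (S : nat)
    (xi : V -> V -> R) : Prop :=
  forall i : V,
    [/\ forall j : V, 0 <= xi i j,
        l1norm (xi i) = 1 &
        forall j : V, 0 < xi i j -> in_ball E i S j].

Definition variation_bound (R : realType) (V : finType) (E : rel V) (S : nat)
    (eps : R) : Prop :=
  0 <= eps /\
  exists2 xi : V -> V -> R, prob_family E S xi &
    forall i j : V, E i j -> l1norm (fun k => xi i k - xi j k) <= eps.

(* [eps] is the minimal variation of probability measures at scale S: the     *)
(* minimum is required to be attained, so this is more than an infimum.       *)
Definition is_min_variation (R : realType) (V : finType) (E : rel V) (S : nat)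
    (eps : R) : Prop :=
  variation_bound E S eps /\
  (forall eps' : R, variation_bound E S eps' -> eps <= eps').

(* Main.v *)
Require Import Defs.
From mathcomp Require Import all_boot all_order all_algebra.
From mathcomp Require Import reals.
From mathcomp Require Import zify ring lra.

Set Implicit Arguments.
Unset Strict Implicit.
Unset Printing Implicit Defensive.

Import Order.TTheory GRing.Theory Num.Theory.
Local Open Scope ring_scope.

(** Below the girth the graph looks like a tree: seen from a target [k], a
    vertex [i] with [0 < dist i k <= S] has exactly one neighbour nearer to [k]
    and [d - 1] neighbours farther from it, while all [d] neighbours of [k] are
    farther ([card_closer], [card_farther]).  The reason is that a walk that
    never turns back and is shorter than the girth repeats no vertex
    ([reduced_uniq]), whereas a second nearer neighbour, or a neighbour at the
    same distance, would close such a walk through two descents to [k].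

    Write [q = d - 1] and let [g r] be the size of a ball of radius [r] divided
    by [q ^ r], that is [(d - 2 / q ^ r) / (d - 2)] ([radial_flux]).  The
    asserted value is [2 / g S].

    The uniform measures on the balls attain it: for adjacent [i] and [j] the
    balls of radius [S] differ in exactly the [q ^ S] vertices at distance [S]
    from [i] and [S + 1] from [j], and as many with [i] and [j] exchanged
    ([card_behind], [variation_uniform]).

    No family does better, by linear programming duality.  For each target [k],
    let an edge leading from distance [r] to distance [r + 1] carry the flux
    [g r] outwards.  The tree structure makes the divergence equal to [d] at
    every vertex of the ball of radius [S] (this is the recurrence [fluxS]), and
    no edge of the ball carries more than [g S].  Summation by parts then gives,
    for every function supported in that ball, a lower bound of its total
    variation over the edges by its sum ([ball_sobolev]).  Applied to
    [i |-> xi i k] and summed over [k], this bounds the average of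
    [l1norm (xi i - xi j)] over the edges from below by [2 / g S]
    ([variation_lower]). *)

(** * Walks and distances *)

Local Arguments adj : simpl never.

Section Distance.

Variables (V : finType) (E : rel V).
Implicit Types (i j k : V) (n : nat).

Lemma adj_sym i j : adj E i j = adj E j i.
Proof. by rewrite /adj /= orbC. Qed.

Fixpoint walk n i k : bool :=
  if n is m.+1 then [exists j, adj E i j && walk m j k] else i == k.

Lemma walkP n i k :
  reflect (exists2 p, joins E i k p & size p = n) (walk n i k).
Proof.
elim: n i => [|n IHn] i /=.
  apply: (iffP eqP) => [->|[p [_ <-] /size0nil ->] //].
  by exists [::].
apply: (iffP existsP) => [[j /andP[ij /IHn[p [jp lp] sp]]]|[[|j p] [ip lp] sp]].
- by exists (j :: p); rewrite /= ?sp //; split=> //=; rewrite ij.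
- by [].
- move: ip => /= /andP[ij jp]; exists j; rewrite ij.
  by apply/IHn; exists p => //; case: sp.
Qed.

(** The value [#|V|] stands for infinity: a shortest walk visits no vertex
    twice, so it has fewer than [#|V|] edges.  With this convention [dist_adj]
    holds across all adjacent pairs, connected to [k] or not. *)
Definition dist i k : nat := find (fun n => walk n i k) (iota 0 #|V|).

Lemma dist_le_card i k : (dist i k <= #|V|)%N.
Proof. by rewrite -[leqRHS](size_iota 0) find_size. Qed.

Lemma dist_le n i k : walk n i k -> (dist i k <= n)%N.
Proof.
move=> w; rewrite leqNgt; apply/negP => lt_n.
have := before_find 0%N lt_n.
by rewrite nth_iota ?w // (leq_trans lt_n) ?dist_le_card.
Qed.

Lemma walk_dist i k : (dist i k < #|V|)%N -> walk (dist i k) i k.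
Proof.
move=> lt_d; have := lt_d; rewrite -[ltnRHS](size_iota 0) -has_find.
by move=> /(nth_find 0%N); rewrite -/(dist i k) nth_iota.
Qed.

Lemma dist_eq0 i k : (dist i k == 0%N) = (i == k).
Proof.
apply/eqP/eqP => [d0|->]; last by apply/eqP; rewrite -leqn0 dist_le /=.
have : walk (dist i k) i k.
  by apply: walk_dist; rewrite d0; apply/card_gt0P; exists i.
by rewrite d0 => /eqP.
Qed.

Lemma dist_adj i j k : adj E i j -> (dist i k <= (dist j k).+1)%N.
Proof.
move=> ij; have [lt_d|ge_d] := ltnP (dist j k) #|V|.
  by apply: dist_le; apply/existsP; exists j; rewrite ij; apply: walk_dist.
by apply: leq_trans (dist_le_card _ _) _; apply: leqW.
Qed.

Lemma dist_closer i k : (0 < dist i k < #|V|)%N ->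
  exists2 j, adj E i j & dist i k = (dist j k).+1.
Proof.
case/andP; case Dr: (dist i k) => [//|r] _ lt_r.
have := @walk_dist i k; rewrite Dr => /(_ lt_r) /existsP[j /andP[ij wj]].
exists j => //; apply/eqP; rewrite eqSS eqn_leq dist_le // andbT.
by rewrite -ltnS -Dr dist_adj.
Qed.

Lemma is_dist_dist i k : (dist i k < #|V|)%N -> is_dist E i k (dist i k).
Proof.
move=> /walk_dist/walkP w; split=> // p ip.
by apply: dist_le; apply/walkP; exists p.
Qed.

Lemma in_ball_dist i n k : in_ball E i n k -> (dist i k <= n)%N.
Proof. by case=> m [/walkP/dist_le le_m _]; apply: leq_trans. Qed.

Definition closer k i j : bool := adj E i j && (dist i k == (dist j k).+1).

Lemma descent i k : (dist i k < #|V|)%N ->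
  exists p, [/\ path (closer k) i p, last i p = k & size p = dist i k].
Proof.
move Dr: (dist i k) => r; elim: r i Dr => [|r IHr] i Dr lt_r.
  by exists [::]; split=> //; apply/eqP; rewrite -dist_eq0 Dr.
have [|j ij] := @dist_closer i k; first by rewrite Dr.
rewrite Dr => -[Dj]; have [p [pP lp sp]] := IHr j (esym Dj) (ltnW lt_r).
by exists (j :: p); split; rewrite /= ?sp // pP /closer ij Dr -Dj eqxx.
Qed.

(** Walks that never traverse an edge back and forth in succession. *)
Fixpoint reduced (s : seq V) : bool :=
  if s is x :: t then
    if t is y :: u then [&& adj E x y, ohead u != Some x & reduced t] else true
  else true.

Local Arguments reduced : simpl never.

Lemma reduced_cons2 x y s :
  reduced [:: x, y & s] = [&& adj E x y, ohead s != Some x & reduced (y :: s)].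
Proof. by []. Qed.

Lemma reduced_path x s : reduced (x :: s) -> path (adj E) x s.
Proof. by elim: s x => //= y s IHs x; rewrite reduced_cons2 => /and3P[-> _ /IHs]. Qed.

Lemma reduced_descent i k p : path (closer k) i p -> reduced (i :: p).
Proof.
elim: p i => //= j p IHp i /andP[/andP[ij /eqP Dij] pP].
rewrite reduced_cons2 ij IHp // andbT.
case: p pP {IHp} => //= l p /andP[/andP[_ /eqP jl] _].
by apply/eqP => -[li]; move: Dij; rewrite jl li; lia.
Qed.

(** Climbing from [k] up to [i] along a descent read backwards, and then going
    on to a vertex [j] that is not nearer to [k]: the vertex before [i] is
    strictly nearer, so it is not [j] and the walk does not turn back at [i]. *)
Lemma reduced_ascent i j k p s : path (closer k) i p ->
  (dist i k <= dist j k)%N -> reduced [:: i, j & s] ->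
  reduced (catrev p [:: i, j & s]).
Proof.
elim: p i j s => [//|l p IHp] i j s /= /andP[/andP[il /eqP Di] pP] le_ij red.
apply: IHp => //; first by rewrite Di.
rewrite reduced_cons2 adj_sym il red andbT /=.
by apply/eqP => -[jl]; move: le_ij; rewrite Di jl; lia.
Qed.

Definition sphere r i := [set k | dist i k == r].

(** For adjacent [i] and [j], this is the part of the sphere about [i] lying on
    the side of [i] away from [j]. *)
Definition behind r i j := [set k | (dist i k == r) && (dist j k == r.+1)].

Definition ball r i := [set k | (dist i k <= r)%N].

(** The distances of [k] from two adjacent vertices differ by at most one, so a
    vertex of one ball missing from the other sits exactly on its boundary. *)
Lemma ball_symdiff (R : realType) n i j k : adj E i j ->
  `|(k \in ball n i)%:R - (k \in ball n j)%:R| =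
    (k \in behind n i j)%:R + (k \in behind n j i)%:R :> R.
Proof.
move=> ij; have le_ij := dist_adj k ij.
have le_ji : (dist j k <= (dist i k).+1)%N by apply: dist_adj; rewrite adj_sym.
rewrite !inE; have [le_i|gt_i] := leqP (dist i k) n;
    have [le_j|gt_j] := leqP (dist j k) n.
- rewrite subrr normr0 [_ == n.+1]ltn_eqF ?ltnS // andbF.
  by rewrite [_ == n.+1]ltn_eqF ?ltnS // andbF addr0.
- have -> : dist i k = n by lia.
  have -> : dist j k = n.+1 by lia.
  by rewrite !eqxx subr0 normr1 (gtn_eqF (ltnSn n)) addr0.
- have -> : dist j k = n by lia.
  have -> : dist i k = n.+1 by lia.
  by rewrite !eqxx sub0r normrN normr1 (gtn_eqF (ltnSn n)) add0r.
- by rewrite subrr normr0 [_ == n]gtn_eqF // [_ == n]gtn_eqF // addr0.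
Qed.

End Distance.

(** * Tree structure of balls below the girth *)

Local Arguments reduced : simpl never.

Section Girth.

Variables (V : finType) (E : rel V) (c : nat).
Hypothesis simpleE : oriented_graph E.
Hypothesis girthE : forall s, graph_cycle E s -> (c <= size s)%N.

Lemma adj_irr i : adj E i i = false.
Proof. by rewrite /adj /= orbb; apply/negP => ii; have := simpleE ii; rewrite ii. Qed.

(** At the last repetition of a vertex [x], counting from the end of the walk,
    the stretch from [x] back to [x] is a cycle: it has no other repetition, and
    it has at least three edges because a loop is excluded by [simpleE] and a
    return after two edges by [reduced]. *)
Lemma reduced_uniq s : reduced E s -> (size s <= c)%N -> uniq s.
Proof.
elim: s => // x t IHt red sz.
have red_t : reduced E t by case: t red {IHt sz} => //= y u; rewrite reduced_cons2 => /and3P[].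
have uniq_t : uniq t by apply: IHt => //; apply: ltnW.
rewrite cons_uniq uniq_t andbT; apply/negP => xt.
case/splitPr: xt red red_t uniq_t sz {IHt} => p q red _ uniq_t.
apply/negP; rewrite -ltnNge.
have pathE : path (adj E) x (rcons p x).
  by have := reduced_path red; rewrite -cat_rcons cat_path => /andP[].
suff cyc : graph_cycle E (x :: p).
  by have := girthE cyc; rewrite /= size_cat /=; lia.
split; last first.
  rewrite /ucycle /= pathE /=; move: uniq_t.
  by rewrite cat_uniq => /and3P[-> /= /norP[-> _] _].
case: p red pathE {uniq_t} => [|y [|z p]] //=.
  by rewrite adj_irr.
by rewrite reduced_cons2 eqxx /= andbF.
Qed.

(** Climbing from [k] to [i], crossing to [j] and returning to [k] is a closed
    walk; being reduced, it cannot be shorter than the girth. *)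
Lemma closed_walk_long i j k p q : path (closer E k) i p -> last i p = k ->
  last j q = k -> (dist E i k <= dist E j k)%N -> reduced E [:: i, j & q] ->
  (c <= (size p + size q).+1)%N.
Proof.
move=> pP lp lq le_ij red; rewrite leqNgt; apply/negP => lt_c.
have := reduced_uniq (reduced_ascent pP le_ij red).
rewrite catrevE size_cat size_rev /= !addnS lt_c => /(_ isT).
rewrite -cat_rcons -rev_cons cat_uniq => /and3P[_ /negP no_k _].
by apply: no_k; apply/hasP; exists k; rewrite ?mem_rev; [rewrite -lq|rewrite -lp]; apply: mem_last.
Qed.

Variable n : nat.
Hypothesis short : (2 * n + 1 < c)%N.
(* Thus a value of dist at most n is a genuine distance, never infinity. *)
Hypothesis smallV : (n < #|V|)%N.

(** Two adjacent vertices at the same distance [r] from [k] would close a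
    reduced walk of length [2 * r + 1]. *)
Lemma adj_dist i j k : adj E i j -> (dist E i k <= n)%N ->
  dist E j k = (dist E i k).+1 \/ dist E i k = (dist E j k).+1.
Proof.
move=> ij le_n.
have le_ij := dist_adj k ij.
have le_ji : (dist E j k <= (dist E i k).+1)%N by apply: dist_adj; rewrite adj_sym.
have [Dij|] := eqVneq (dist E j k) (dist E i k); last by move/eqP; lia.
have [p [pP lp sp]] := descent (leq_ltn_trans le_n smallV).
have [|q [qP lq sq]] := @descent _ E j k; first by rewrite Dij (leq_ltn_trans le_n).
suff /(closed_walk_long pP lp lq) : reduced E [:: i, j & q].
  by rewrite Dij leqnn sp sq Dij => /(_ isT); lia.
rewrite reduced_cons2 ij (reduced_descent qP) andbT /=.
case: q qP {lq sq} => //= l q /andP[/andP[_ /eqP jl] _].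
by apply/eqP => -[li]; move: jl; rewrite Dij li; lia.
Qed.

(** Two different nearer neighbours of [i] would close a reduced walk of length
    [2 * dist i k], with its turning point at [i]. *)
Lemma closer_inj i j l k : (dist E i k <= n)%N ->
  closer E k i j -> closer E k i l -> j = l.
Proof.
move=> le_n /andP[ij /eqP Dj] /andP[il /eqP Dl].
have [p [pP lp sp]] : exists p,
    [/\ path (closer E k) j p, last j p = k & size p = dist E j k].
  by apply: descent; lia.
have [q [qP lq sq]] : exists p,
    [/\ path (closer E k) l p, last l p = k & size p = dist E l k].
  by apply: descent; lia.
apply/eqP; apply: contraTT short => neq_jl; rewrite -leqNgt.
have red : reduced E [:: i, l & q].
  by apply: (@reduced_descent _ _ _ k); rewrite /= qP /closer il Dl eqxx.
have := @closed_walk_long j i k p (l :: q) pP lp lq.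
rewrite Dj leqnSn /= => /(_ isT); rewrite reduced_cons2 adj_sym ij /= sp sq.
have -> : Some l != Some j by apply: contra_neq neq_jl => -[].
by rewrite red => /(_ isT); lia.
Qed.

Lemma card_closer i k : (dist E i k <= n)%N ->
  #|[set j | closer E k i j]| = (0 < dist E i k)%N.
Proof.
move=> le_n; have [d_gt0|] := ltnP 0 (dist E i k).
  have [|j ij Dj] := @dist_closer _ E i k; first by rewrite d_gt0; lia.
  have cj : closer E k i j by rewrite /closer ij Dj eqxx.
  apply/eqP/cards1P; exists j; apply/setP => l; rewrite !inE.
  by apply/idP/eqP => [cl|->]; [apply: (closer_inj le_n cl cj)|].
rewrite leqn0 => /eqP d0; apply/eqP; rewrite cards_eq0; apply/eqP/setP => j.
by rewrite !inE /closer d0 andbF.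
Qed.

Variable d : nat.
Hypothesis regE : regular E d.

Lemma card_farther i k : (dist E i k <= n)%N ->
  (#|[set j | closer E k j i]| + (0 < dist E i k))%N = d.
Proof.
move=> le_n; rewrite -(card_closer le_n) -(regE i) -cardsUI.
rewrite [X in (_ + X)%N](_ : _ = 0%N) ?addn0; last first.
  apply/eqP; rewrite cards_eq0; apply/eqP/setP => j; rewrite !inE.
  by apply/negP => /andP[/andP[_ /eqP Dj] /andP[_ /eqP Di]]; lia.
apply: eq_card => j; rewrite !inE /closer [adj E j i]adj_sym -andb_orr.
have [ij|//] := boolP (adj E i j).
by case: (adj_dist ij le_n) => ->; rewrite eqxx ?orbT.
Qed.

(** A vertex of the sphere about [i] is either farther from [j], or nearer to
    [j], and in the latter case it is behind [j] as seen from [i]. *)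
Lemma card_sphere_behind r i j : adj E i j -> (r < n)%N ->
  #|sphere E r.+1 i| = (#|behind E r.+1 i j| + #|behind E r j i|)%N.
Proof.
move=> ij lt_r; rewrite -cardsUI [X in (_ + X)%N](_ : _ = 0%N) ?addn0.
  apply: eq_card => k; rewrite !inE [X in _ || X]andbC -andb_orr.
  have [Di|//] := eqVneq (dist E i k) r.+1.
  have := @adj_dist i j k ij; rewrite Di => /(_ lt_r) [->|[->]];
    by rewrite eqxx ?orbT.
apply/eqP; rewrite cards_eq0; apply/eqP/setP => k; rewrite !inE.
by apply/negP => /andP[/andP[_ /eqP Dj] /andP[/eqP Dj' _]]; lia.
Qed.

(** Each [k] at distance [r + 1] from [i] is counted once, by the only
    neighbour of [i] nearer to [k]. *)
Lemma sum_behind r i : (r < n)%N ->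
  \sum_(j | adj E i j) #|behind E r j i| = #|sphere E r.+1 i|.
Proof.
move=> lt_r; under eq_bigr => j _ do rewrite -sum1_card.
rewrite (exchange_big_dep (fun k => k \in sphere E r.+1 i)) /=; last first.
  by move=> j k _; rewrite !inE => /andP[].
rewrite -[RHS]sum1_card; apply: eq_bigr => k; rewrite inE => /eqP Di.
rewrite sum1_card; have := @card_closer i k; rewrite Di => /(_ lt_r) /= <-.
by apply: eq_card => j; rewrite inE /closer Di eqSS unfold_in inE Di eqxx andbT eq_sym.
Qed.

(** By [card_sphere_behind] and [sum_behind], passing from [r] to [r + 1] turns
    a common value [b] into [d * b - b], for all edges at once. *)
Lemma card_behind r i j : adj E i j -> (r <= n)%N -> #|behind E r i j| = (d.-1 ^ r)%N.
Proof.
elim: r i j => [|r IHr] i j ij le_r.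
  rewrite expn0 -(cards1 i); apply: eq_card => k.
  rewrite !inE dist_eq0 eq_sym; have [->|//] := eqVneq k i.
  rewrite /= eqn_leq lt0n dist_eq0; have ji : adj E j i by rewrite adj_sym.
  have := dist_adj i ji; have /eqP -> : dist E i i == 0%N by rewrite dist_eq0.
  by move=> ->; apply: contraTneq ij => ->; rewrite adj_irr.
have := card_sphere_behind ij le_r.
rewrite -sum_behind // (eq_bigr (fun=> (d.-1 ^ r)%N)); last first.
  by move=> l il; apply: IHr; [rewrite adj_sym|apply: ltnW].
rewrite IHr 1?adj_sym 1?ltnW // sum_nat_const.
rewrite (_ : #|_| = d); last by rewrite -(regE i); apply: eq_card => l; rewrite inE.
have : (0 < d)%N by rewrite -(regE i); apply/card_gt0P; exists j; rewrite inE.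
by case: d => // q _; rewrite expnS mulSn /= => ?; lia.
Qed.

Lemma card_sphere r i : (r < n)%N -> #|sphere E r.+1 i| = (d * d.-1 ^ r)%N.
Proof.
move=> lt_r; rewrite -sum_behind // (eq_bigr (fun=> (d.-1 ^ r)%N)); last first.
  by move=> l il; rewrite card_behind 1?adj_sym // ltnW.
rewrite sum_nat_const (_ : #|_| = d) //.
by rewrite -(regE i); apply: eq_card => l; rewrite inE.
Qed.

Lemma card_ball r i : (2 <= d)%N -> (r <= n)%N ->
  ((d - 2) * #|ball E r i| + 2 = d * d.-1 ^ r)%N.
Proof.
move=> d_ge2; elim: r => [|r IHr] le_r.
  rewrite (_ : #|_| = 1%N) ?expn0 ?muln1 ?subnK // -(cards1 i).
  by apply: eq_card => k; rewrite !inE leqn0 dist_eq0 eq_sym.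
have -> : #|ball E r.+1 i| = (#|ball E r i| + d * d.-1 ^ r)%N.
  rewrite -(card_sphere i le_r) -cardsUI [X in (_ + X)%N](_ : _ = 0%N) ?addn0.
    by apply: eq_card => k; rewrite !inE leq_eqVlt ltnS orbC.
  apply/eqP; rewrite cards_eq0; apply/eqP/setP => k; rewrite !inE.
  by apply/negP => /andP[le_k /eqP Dk]; lia.
rewrite mulnDr addnAC IHr ?(ltnW le_r) // expnS [RHS]mulnCA -mulSn.
by congr (_ * _)%N; lia.
Qed.


End Girth.

(** * The radial flux *)

Section Flux.

Variables (R : realType) (d : nat).
Hypothesis d_ge3 : (3 <= d)%N.

(** The ratio of the size of a ball of radius [r] to [(d - 1) ^ r], in closed
    form ([card_ball_flux] below). *)
Definition radial_flux r : R := (d%:R - 2 / d.-1%:R ^+ r) / (d%:R - 2).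

Lemma natr_deg_gt2 : (2 : R) < d%:R. Proof. by rewrite ltr_nat. Qed.

Lemma natr_pred_deg : d.-1%:R = d%:R - 1 :> R.
Proof. by rewrite -subn1 natrB //; lia. Qed.

Lemma branch_gt1 : (1 : R) < d.-1%:R.
Proof. by rewrite ltr1n; lia. Qed.

Lemma flux0 : radial_flux 0 = 1.
Proof. by have := natr_deg_gt2; rewrite /radial_flux expr0 divr1 => ?; rewrite divff //; lra. Qed.

(** The divergence, at distance [r + 1] from the target, of the flow that
    carries [radial_flux r] outwards across each edge between distances [r] and
    [r + 1]: [d - 1] edges lead outwards and one edge inwards. *)
Lemma fluxS r : d.-1%:R * radial_flux r.+1 - radial_flux r = d%:R.
Proof.
have d2 := natr_deg_gt2; have q1 := branch_gt1.
rewrite /radial_flux exprS natr_pred_deg; field.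
rewrite -natr_pred_deg expf_neq0 ?lt0r_neq0 //; lra.
Qed.

Lemma flux_le r s : (r <= s)%N -> radial_flux r <= radial_flux s.
Proof.
move=> le_rs; have d2 := natr_deg_gt2; have q1 := branch_gt1.
rewrite ler_pM2r ?invr_gt0; last by lra.
rewrite lerD2l lerN2 ler_pM2l // lef_pV2 ?posrE ?exprn_gt0 //; try lra.
by rewrite ler_weXn2l // ltW.
Qed.

Lemma flux_gt0 r : 0 < radial_flux r.
Proof. by rewrite (lt_le_trans ltr01) // -flux0 flux_le. Qed.

Lemma variation_flux r :
  2 * (d%:R - 1) ^+ r * (2 - d%:R) / (2 - d%:R * (d%:R - 1) ^+ r) = 2 / radial_flux r.
Proof.
have d2 := natr_deg_gt2; have q1 := branch_gt1.
rewrite /radial_flux -natr_pred_deg.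
have : 1 <= (d.-1%:R : R) ^+ r by rewrite exprn_ege1 // ltW.
move: (_ ^+ r) => Q Q1.
have dQ : 2 < d%:R * Q by rewrite (lt_le_trans d2) // ler_peMr //; lra.
field; rewrite [2 - _ == 0]subr_eq0 [2 == _]eq_sym -subr_eq0.
by rewrite !lt0r_neq0 ?subr_gt0 //; lra.
Qed.

End Flux.

(** * The uniform family and the dual bound *)

Section Variation.

Variables (R : realType) (V : finType) (E : rel V) (d c n : nat).
Hypothesis simpleE : oriented_graph E.
Hypothesis regE : regular E d.
Hypothesis girthE : forall s, graph_cycle E s -> (c <= size s)%N.
Hypothesis d_ge3 : (3 <= d)%N.
Hypothesis short : (2 * n + 1 < c)%N.
Hypothesis smallV : (n < #|V|)%N.

Local Notation flux := (radial_flux R d).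

Lemma card_adj i : #|[pred j | adj E i j]| = d.
Proof. by rewrite -(regE i); apply: eq_card => j; rewrite !inE. Qed.

Lemma card_ball_flux i : #|ball E n i|%:R = flux n * d.-1%:R ^+ n :> R.
Proof.
have d2 := natr_deg_gt2 R d_ge3; have q1 := branch_gt1 R d_ge3.
have := card_ball simpleE girthE short smallV regE i (ltnW d_ge3) (leqnn n).
move/(congr1 (fun m => m%:R : R)).
rewrite natrD !natrM natrX natrB ?(ltnW d_ge3) // => DB.
have Q0 : d.-1%:R ^+ n != 0 :> R by rewrite expf_neq0 // lt0r_neq0 //; lra.
have d2N0 : (d%:R : R) - 2 != 0 by rewrite lt0r_neq0 //; lra.
apply: (mulfI d2N0); rewrite /radial_flux.
transitivity (d%:R * d.-1%:R ^+ n - 2 : R); first by rewrite -DB addrK.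
by field; rewrite d2N0.
Qed.

Lemma variation_uniform : variation_bound E n (2 / flux n).
Proof.
have g0 := flux_gt0 R d_ge3 n; have q1 := branch_gt1 R d_ge3.
have Q0 : 0 < d.-1%:R ^+ n :> R by rewrite exprn_gt0 //; lra.
split; first by rewrite divr_ge0 // ltW.
pose N := flux n * d.-1%:R ^+ n.
have N0 : 0 < N by rewrite mulr_gt0.
exists (fun i k => (k \in ball E n i)%:R / N).
  move=> i; split=> [k||k].
  - by rewrite divr_ge0 // ltW.
  - rewrite /l1norm; under eq_bigr do rewrite ger0_norm ?divr_ge0 // 1?ltW //.
    rewrite -mulr_suml -natr_sum -big_mkcond sum1_card card_ball_flux.
    by rewrite divff // gt_eqF.
  - rewrite inE; have [le_k _|_] := leqP (dist E i k) n; last by rewrite mul0r ltxx.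
    by exists (dist E i k) => //; apply/is_dist_dist/(leq_ltn_trans le_k).
move=> i j ij; have aij : adj E i j by rewrite /adj /= ij.
have aji : adj E j i by rewrite adj_sym.
rewrite /l1norm; under eq_bigr => k _ do
  rewrite -mulrBl normrM (ball_symdiff R n k aij) [`|N^-1|]gtr0_norm ?invr_gt0 //.
rewrite -mulr_suml big_split /= -!natr_sum -!big_mkcond !sum1_card.
rewrite !(card_behind simpleE girthE short smallV regE) // natrX.
by rewrite le_eqVlt; apply/orP/or_introl/eqP; rewrite /N; field; rewrite !gt_eqF.
Qed.

(** This is the integrated form of the isoperimetric inequality in the ball
    about [k], equality holding for the indicator of the ball.  It follows by
    testing the differences of [f] against the radial flow [w]. *)
Lemma ball_sobolev k (f : V -> R) :
  (forall i, (n < dist E i k)%N -> f i = 0) ->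
  2 * d%:R * \sum_i f i <=
    flux n * \sum_i \sum_(j | adj E i j) `|f i - f j|.
Proof.
(* Capping the radius at n bounds w everywhere by flux n; it changes w only on
   edges both of whose ends lie outside the ball. *)
move=> f0; pose g r := flux (minn r n).
pose w i j := (closer E k j i)%:R * g (dist E i k)
            - (closer E k i j)%:R * g (dist E j k).
have wN i j : w j i = - w i j by rewrite /w opprB.
have w_le i j : `|w i j| <= flux n.
  have g_le r : 0 <= g r <= flux n.
    by rewrite ltW ?flux_gt0 // flux_le // geq_minr.
  have /andP[gi0 gin] := g_le (dist E i k); have /andP[gj0 gjn] := g_le (dist E j k).
  rewrite /w; have [/andP[_ /eqP Dj]|_] := boolP (closer E k j i);
    have [/andP[_ /eqP Di]|_] := boolP (closer E k i j).
  - by exfalso; lia.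
  - by rewrite mul1r mul0r subr0 ger0_norm.
  - by rewrite mul1r mul0r sub0r normrN ger0_norm.
  - by rewrite !mul0r subr0 normr0 (le_trans gi0).
have w_adj i j : ~~ adj E i j -> w i j = 0.
  by move=> nij; rewrite /w /closer [adj E j i]adj_sym (negbTE nij) !mul0r subr0.
have div_w i : (dist E i k <= n)%N -> \sum_j w i j = d%:R.
  move=> le_i; rewrite sumrB -mulr_suml -natr_sum -big_mkcond sum1dep_card.
  have -> : \sum_j (closer E k i j)%:R * g (dist E j k)
          = (0 < dist E i k)%N%:R * g (dist E i k).-1.
    have <- := card_closer simpleE girthE short smallV le_i.
    rewrite -sum1_card natr_sum mulr_suml [RHS]big_mkcond /=.
    apply: eq_bigr => j _; rewrite inE.
    by case: ifP => [/andP[_ /eqP ->]|_]; rewrite ?mul0r.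
  have := card_farther simpleE girthE short smallV regE le_i.
  rewrite /g; case: (dist E i k) le_i => [|r] le_i /=.
    by rewrite addn0 min0n flux0 // => ->; rewrite mul0r subr0 mulr1.
  rewrite addn1 => Dd; rewrite mul1r !(minn_idPl _) ?(ltnW le_i) //.
  by rewrite -[RHS](fluxS R d_ge3 r) -Dd.
have wf : \sum_i \sum_j w i j * f i = d%:R * \sum_i f i.
  rewrite mulr_sumr; apply: eq_bigr => i _; rewrite -mulr_suml.
  have [le_i|gt_i] := leqP (dist E i k) n; first by rewrite div_w.
  by rewrite f0 // !mulr0.
have -> : 2 * d%:R * \sum_i f i =
    \sum_i \sum_(j | adj E i j) w i j * (f i - f j).
  transitivity (\sum_i \sum_j w i j * (f i - f j)); last first.
    apply: eq_bigr => i _; rewrite [RHS]big_mkcond; apply: eq_bigr => j _.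
    by case: ifP => // /negbT/w_adj ->; rewrite mul0r.
  transitivity (\sum_i \sum_j w i j * f i - \sum_i \sum_j w i j * f j).
    rewrite [X in _ - X]exchange_big /=.
    under [X in _ - X]eq_bigr => j _.
      under eq_bigr => i _ do rewrite wN mulNr.
      rewrite sumrN; over.
    rewrite sumrN opprK wf; ring.
  rewrite -sumrB; apply: eq_bigr => i _; rewrite -sumrB.
  by apply: eq_bigr => j _; rewrite mulrBr.
rewrite mulr_sumr; apply: ler_sum => i _; rewrite mulr_sumr.
apply: ler_sum => j _; apply: le_trans (ler_norm _) _.
by rewrite normrM ler_wpM2r.
Qed.

(** Summing [ball_sobolev] for [i |-> xi i k] over all [k] compares total mass,
    one per vertex, with the sum of the variations over ordered adjacent pairs,
    of which there are [d] per vertex. *)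
Lemma variation_lower eps : variation_bound E n eps -> 2 / flux n <= eps.
Proof.
have g0 := flux_gt0 R d_ge3 n; have d2 := natr_deg_gt2 R d_ge3.
case=> eps0 [xi xiP xiE]; rewrite ler_pdivrMr //.
have V0 : 0 < #|V|%:R :> R by rewrite ltr0n (leq_trans _ smallV).
have xi_far i k : (n < dist E i k)%N -> xi i k = 0.
  have [xi_ge0 _ xi_ball] := xiP i; rewrite ltnNge.
  by apply: contraNeq => nz; apply/in_ball_dist/xi_ball; rewrite lt0r nz xi_ge0.
have xi_sum i : \sum_k xi i k = 1.
  have [xi_ge0 <- _] := xiP i; apply: eq_bigr => k _.
  by rewrite ger0_norm.
have xi_adj i j : adj E i j -> l1norm (fun k => xi i k - xi j k) <= eps.
  case/orP=> [/xiE //|/xiE]; apply: le_trans.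
  by rewrite le_eqVlt; apply/orP/or_introl/eqP/eq_bigr => k _; rewrite distrC.
have : \sum_k 2 * d%:R * \sum_i xi i k <=
    \sum_k flux n * \sum_i \sum_(j | adj E i j) `|xi i k - xi j k|.
  apply: ler_sum => k _; apply: (ball_sobolev (k := k) (f := xi^~ k)) => i.
  exact: xi_far.
rewrite -!mulr_sumr exchange_big /= (eq_bigr (fun=> 1)) // sumr_const.
rewrite exchange_big /=.
have : \sum_i \sum_k \sum_(j | adj E i j) `|xi i k - xi j k| <= #|V|%:R * (d%:R * eps).
  rewrite [leRHS]mulr_natl -[leRHS]sumr_const.
  apply: ler_sum => i _; rewrite exchange_big /=.
  rewrite -[X in _ <= X%:R * _](card_adj i) mulr_natl -sumr_const.
  by apply: ler_sum => j; apply: xi_adj.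
move=> up lo; have := le_trans lo (ler_wpM2l (ltW g0) up).
rewrite [leRHS](_ : _ = #|V|%:R * d%:R * (eps * flux n)); last by ring.
rewrite [leLHS](_ : _ = #|V|%:R * d%:R * 2); last by rewrite mulrC; ring.
by rewrite ler_pM2l // mulr_gt0 //; lra.
Qed.

End Variation.

Theorem theorem9p1 (R : realType) (V : finType) (E : rel V) (d c S : nat)
    (hE : oriented_graph E) (hreg : regular E d) (hgirth : is_girth E c)
    (hd : (3 <= d)%N) (hS : (2 * S + 1 < c)%N) :
  is_min_variation E S
    (2 * (d%:R - 1) ^+ S * (2 - d%:R) / (2 - d%:R * (d%:R - 1) ^+ S) : R).
Proof.
(* The vertices of a shortest cycle are distinct, so there are at least c. *)
case: hgirth => -[s [_ /andP[_ uniq_s]] sz_s] girthE.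
have smallV : (S < #|V|)%N.
  by have := max_card (mem s); rewrite (card_uniqP uniq_s) sz_s; lia.
rewrite variation_flux //; split; first exact: (variation_uniform _ hE hreg girthE).
by move=> eps; apply: (variation_lower hE hreg girthE).
Qed.
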